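(* Let $n \geq 6$ and $\epsilon > 0$. Then for any $H \geq 1$, the number of monic irreducible polynomials $f(x) = x^n + c_1x^{n-1} + \cdots + c_n \in \mathbb{Z}[x]$ with $\lvert c_i \rvert \leq H^i$ for all $i$, such that $\mathrm{rad}(\mathrm{index}(f)) < H^{1-\epsilon}$ and $\mathrm{index}(f) > H^{\frac{n(n-3)}{2}}$, is \[ O_{n,\epsilon}\!\left(H^{\frac{n^2+n}{2} - \frac{4}{3} - \frac{4}{n} + \epsilon} + H^{\frac{n^2+n}{2} - \frac{2n}{3} + 3 + \epsilon}\right). \]
   Context: For a monic irreducible $f \in \mathbb{Z}[x]$ with a root $\alpha$, cutting out the field $K = \mathbb{Q}(\alpha)$, $\mathrm{index}(f) := [\mathcal{O}_K : \mathbb{Z}[\alpha]]$, so that $\mathrm{disc}(f) = \mathrm{Disc}(K)\,\mathrm{index}(f)^2$. For a positive integer $m$, $\mathrm{rad}(m)$ is the product of the distinct primes dividing $m$. The implied constant depends only on $n$ and $\epsilon$. *)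

(* Defs.v *)
From HB Require Import structures.
From mathcomp Require Import all_boot all_order all_algebra all_field.
From mathcomp Require Import finmap.
From mathcomp Require Import all_classical all_reals all_analysis.
Set Implicit Arguments.
Unset Strict Implicit.
Unset Printing Implicit Defensive.
Import Order.TTheory GRing.Theory Num.Theory.

Local Open Scope classical_set_scope.
Local Open Scope ring_scope.

(* Irreducible element of a commutative ring; on {poly int} the units are the
   constants 1 and -1. *)
Definition irreducible_elt (A : comUnitRingType) (a : A) : Prop :=
  [/\ a != 0, a \isn't a GRing.unit &
      forall b c : A, a = b * c -> (b \is a GRing.unit) || (c \is a GRing.unit)].

(* Number of elements of a finite set; fset_set makes it 0 on infinite sets. *)
Definition set_size (T : choiceType) (A : set T) : nat :=
  (#|` fset_set A|)%fset.

Definition left_cosets (G : zmodType) (A B : set G) : set (set G) :=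
  [set [set x + b | b in B] | x in A].

(* [A : B] for a subgroup B of A. *)
Definition subgroup_index (G : zmodType) (A B : set G) : nat :=
  set_size (left_cosets A B).

Definition adjoinZ (alpha : algC) : set algC :=
  [set (map_poly intr p).[alpha] | p in [set: {poly int}]].

Definition adjoinQ (alpha : algC) : set algC :=
  [set x | exists p q : {poly rat},
     x = (map_poly ratr p).[alpha] / (map_poly ratr q).[alpha]].

Definition ring_of_integers (K : set algC) : set algC :=
  [set x | K x /\ integralOver (intr : int -> algC) x].

(* An arbitrary complex root of f (junk value 0 if f has none); the index below
   does not depend on which root of an irreducible f is picked. *)
Definition a_root (f : {poly int}) : algC :=
  xget 0 [set alpha | root (map_poly intr f) alpha].

Definition poly_index (f : {poly int}) : nat :=
  subgroup_index (ring_of_integers (adjoinQ (a_root f))) (adjoinZ (a_root f)).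

Definition rad_nat (m : nat) : nat := (\prod_(p <- primes m) p)%N.

(* The coefficient c_i of 'X^(n - i) is f`_(n - i). *)
Definition counted_polys (R : realType) (n : nat) (eps H : R) :
    set {poly int} :=
  [set f | [/\ f \is monic, size f = n.+1, irreducible_elt f,
      forall i : nat, (1 <= i <= n)%N -> `|(f`_(n - i))%:~R| <= H ^+ i &
      (rad_nat (poly_index f))%:R < H `^ (1 - eps) /\
      H `^ (n%:R * (n%:R - 3) / 2) < (poly_index f)%:R]].

(* Main.v *)
(* For f monic irreducible with roots alpha_i, and gamma_j the roots of f', an integral basis
   h'_j(alpha) of O_K gives prod_i f'(alpha_i) = +- det(h'_j(alpha_i))^2 index(f)^2, so index(f)^2
   divides prod_i f'(alpha_i) in the algebraic integers.  With c_1, ..., c_(n-1) fixed, this product is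
   n^n prod_j (f_0(gamma_j) + c), a polynomial P of degree n - 1 in c = c_n.  By Lagrange
   interpolation, p^(2k) | P(c) leaves at most n - 1 classes for c modulo p^s, where s is about
   2k / (n - 1).  Rounding s down to an even number costs at most one factor p, so c lies in at most
   (n - 1)^omega(Y) classes modulo Y^2, where Y^(2(n-1)) n^n rad(index)^(n-1) >= index^2.  Replacing
   Y by a minimal divisor above the threshold H^(e1), e1 = (n^2 - 4n + 1) / (2(n - 1)), keeps
   Y^2 <= H^n because every prime factor is less than H.  Summing the n-th coefficient count
   (n - 1)^omega(Y) H^n / Y^2 over Y >= H^(e1) saves a factor of nearly H^(e1), which is at
   least what either term of the bound asks for. *)
Require Import Defs.
From HB Require Import structures.
From mathcomp Require Import all_boot all_order all_algebra all_field.
From mathcomp Require Import finmap.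
From mathcomp Require Import all_classical all_reals all_analysis.
From mathcomp Require Import zify ring lra.
Set Implicit Arguments.
Unset Strict Implicit.
Unset Printing Implicit Defensive.
Import Order.TTheory GRing.Theory Num.Theory.

Local Open Scope classical_set_scope.
Local Open Scope ring_scope.

(** * Cosets of subgroups of finite index *)

Definition subgroup_set (G : zmodType) (A : set G) : Prop :=
  A 0 /\ forall x y, A x -> A y -> A (x - y).

Section SubgroupSet.
Variables (G : zmodType) (A : set G).
Hypothesis sA : subgroup_set A.

Lemma subgroup_setN x : A x -> A (- x).
Proof. by move=> Ax; rewrite -sub0r; apply: sA.2 => //; exact: sA.1. Qed.

Lemma subgroup_setD x y : A x -> A y -> A (x + y).
Proof. by move=> Ax Ay; rewrite -[y]opprK; apply: sA.2 => //; exact: subgroup_setN. Qed.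

Lemma subgroup_setMn x k : A x -> A (x *+ k).
Proof.
move=> Ax; elim: k => [|k IHk]; first by rewrite mulr0n; exact: sA.1.
by rewrite mulrS; exact: subgroup_setD.
Qed.

Lemma subgroup_setMz x (k : int) : A x -> A (x *~ k).
Proof.
move=> Ax; case: k => k; first exact: subgroup_setMn.
by rewrite NegzE mulrNz; apply: subgroup_setN; exact: subgroup_setMn.
Qed.

Lemma subgroup_set_sum (I : Type) (r : seq I) (P : pred I) (F : I -> G) :
  (forall i, A (F i)) -> A (\sum_(i <- r | P i) F i).
Proof. by move=> AF; elim/big_ind: _ => //; [exact: sA.1|exact: subgroup_setD]. Qed.

End SubgroupSet.

Definition coset_set (G : zmodType) (L : set G) (x : G) : set G :=
  [set x + l | l in L].

Lemma coset_setP (G : zmodType) (L : set G) (x z : G) :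
  coset_set L x z <-> L (z - x).
Proof.
split=> [[l Ll <-]|Lzx]; first by rewrite addrAC subrr add0r.
by exists (z - x) => //; rewrite addrC subrK.
Qed.

Lemma coset_set_eq (G : zmodType) (L : set G) (x y : G) : subgroup_set L ->
  coset_set L x = coset_set L y <-> L (x - y).
Proof.
move=> sL; split=> [eqxy|Lxy].
  have : coset_set L x x by apply/coset_setP; rewrite subrr; exact: sL.1.
  by rewrite eqxy => /coset_setP.
apply/seteqP; split=> z /coset_setP Lz; apply/coset_setP.
  have -> : z - y = (z - x) + (x - y) by rewrite addrA subrK.
  exact: subgroup_setD.
have -> : z - x = (z - y) - (x - y) by rewrite opprB addrA subrK.
exact: sL.2.
Qed.

Section IndexStep.
Variables (G : comNzRingType) (B L : set G) (b : G) (p : nat).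
Hypotheses (sB : subgroup_set B) (sL : subgroup_set L) (LB : L `<=` B).
Hypotheses (p_gt0 : (0 < p)%N) (Bb : B b) (Lpb : L (b *+ p)).
Hypothesis Lib : forall i, (0 < i < p)%N -> ~ L (b *+ i).

Let L' : set G := [set x | exists i : nat, L (x - b *+ i)].

Lemma extension_canon x : L' x -> exists2 i : 'I_p, True & L (x - b *+ i).
Proof.
case=> i Lxi; exists (Ordinal (ltn_pmod i p_gt0)) => //=.
have -> : x - b *+ (i %% p) = (x - b *+ i) + b *+ p *+ (i %/ p).
  by rewrite {2}(divn_eq i p) mulrnDr mulnC mulrnA; ring.
by apply: (subgroup_setD sL) => //; exact: subgroup_setMn.
Qed.

Lemma extension_subgroup : subgroup_set L'.
Proof.
split; first by exists 0%N; rewrite mulr0n subrr; exact: sL.1.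
move=> x y [i Li] /extension_canon[j _ Lj]; exists (i + (p - j))%N.
have -> : x - y - b *+ (i + (p - j)) = (x - b *+ i) - (y - b *+ j) - b *+ p.
  by rewrite mulrnDr mulrnBr ?(ltnW (ltn_ord j)) //; ring.
by apply: sL.2 => //; exact: sL.2.
Qed.

Lemma extension_sub : L `<=` L'.
Proof. by move=> x Lx; exists 0%N; rewrite mulr0n subr0. Qed.

Lemma extension_subB : L' `<=` B.
Proof.
move=> x [i Lx]; rewrite -(subrK (b *+ i) x).
by apply: (subgroup_setD sB); [exact: LB | exact: subgroup_setMn].
Qed.

Hypothesis finL : finite_set (left_cosets B L).

Lemma extension_finite : finite_set (left_cosets B L').
Proof.
apply: (sub_finite_set _ (finite_image (fun C => [set z | exists2 x, C x & L' (z - x)]) finL)).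
move=> _ [x Bx <-]; exists (coset_set L x); first by exists x.
apply/seteqP; split=> z.
  move=> [y /coset_setP/extension_sub Ly Lzy]; apply/coset_setP.
  have -> : z - x = (z - y) + (y - x) by rewrite addrA subrK.
  exact: (subgroup_setD extension_subgroup).
move=> /coset_setP Lz; exists x => //; apply/coset_setP.
by rewrite subrr; exact: sL.1.
Qed.

Lemma subgroup_index_extension :
  subgroup_index B L = (p * subgroup_index B L')%N.
Proof.
pose T := fset_set (left_cosets B L); pose T' := fset_set (left_cosets B L').
have sL' := extension_subgroup.
pose rep (C : set G) := xget 0 C.
have repP C : C \in T' -> exists2 x, B x & C = coset_set L' x /\ L' (rep C - x).
  rewrite in_fset_set; last exact: extension_finite.
  rewrite inE => -[x Bx <-]; exists x => //; split=> //.
  apply/coset_setP; rewrite /rep; apply: (@xgetPex _ 0 (coset_set L' x)).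
  by exists x; apply/coset_setP; rewrite subrr; exact: sL'.1.
pose phi (C : set G) (i : 'I_p) := coset_set L (rep C + b *+ i).
pose s := [seq phi C i | C <- T', i <- enum 'I_p].
have us : uniq s.
  apply: allpairs_uniq; [exact: fset_uniq | exact: enum_uniq |].
  move=> _ _ /allpairsP[[C i] /= [TC _ ->]] /allpairsP[[D j] /= [TD _ ->]].
  move=> /(coset_set_eq _ _ sL).
  rewrite /= => Lphi.
  have eqCD : C = D.
    have [x Bx [eC Cx]] := repP _ TC.
    have [y By [eD Dy]] := repP _ TD.
    rewrite eC eD; apply/(coset_set_eq _ _ sL').
    have -> : x - y = (rep D - y) - (rep C - x) + (rep C + b *+ i - (rep D + b *+ j)) + b *+ j - b *+ i.
      by ring.
    have bL k : L' (b *+ k) by exists k; rewrite subrr; exact: sL.1.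
    apply: sL'.2 => //; apply: (subgroup_setD sL') => //.
    apply: (subgroup_setD sL'); last exact: extension_sub.
    exact: sL'.2.
  congr pair => //; apply/val_inj => /=.
  move: Lphi; rewrite eqCD opprD addrACA subrr add0r => Lij.
  have aux (k l : 'I_p) : (k < l)%N -> L (b *+ l - b *+ k) -> False.
    move=> kl; rewrite -mulrnBr ?(ltnW kl) //; apply: Lib.
    by rewrite subn_gt0 kl /= (leq_ltn_trans (leq_subr _ _)).
  case: (ltngtP i j) => // ij; exfalso.
    by apply: (aux _ _ ij); rewrite -opprB; exact: (subgroup_setN sL).
  exact: (aux _ _ ij).
have sT : s =i T.
  move=> C; apply/idP/idP; last first.
    rewrite in_fset_set // inE => -[x Bx <-].
    have TC : coset_set L' x \in T'.
      by rewrite in_fset_set ?inE; [exists x | exact: extension_finite].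
    have [y By [/(coset_set_eq _ _ sL') eC Cy]] := repP _ TC.
    have : L' (x - rep (coset_set L' x)).
      rewrite -(subrKA y); apply: (subgroup_setD sL') => //.
      by rewrite -opprB; exact: (subgroup_setN sL').
    move=> /extension_canon[i _ Lx].
    apply/allpairsP; exists (coset_set L' x, i) => /=; split=> //.
      by rewrite mem_enum.
    by apply/coset_set_eq => //; rewrite /= opprD addrA.
  move=> /allpairsP[[D i]] /= [TD _ ->].
  rewrite in_fset_set // inE; exists (rep D + b *+ i) => //.
  have [y By [eD /extension_subB Dy]] := repP _ TD.
  apply: (subgroup_setD sB); last exact: subgroup_setMn.
  by rewrite -(subrK y (rep D)); exact: subgroup_setD.
rewrite /subgroup_index /set_size -/T -/T' -(perm_size (uniq_perm us (fset_uniq T) sT)).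
by rewrite size_allpairs -cardE card_ord mulnC.
Qed.

End IndexStep.

Lemma exists_prime_order (G : comNzRingType) (B L : set G) (b : G) :
  subgroup_set B -> subgroup_set L -> finite_set (left_cosets B L) ->
  B b -> ~ L b ->
  exists c p, [/\ prime p, B c, ~ L c & L (c *+ p)].
Proof.
move=> sB sL finL Bb Lb.
have exk : exists k, (0 < k)%N && `[< L (b *+ k) >].
  pose T := fset_set (left_cosets B L).
  pose F k := coset_set L (b *+ k); pose r := iota 0 (#|` T|%fset).+1.
  have nuniq : ~~ uniq [seq F k | k <- r].
    apply/negP => ur.
    have /(uniq_leq_size ur) : {subset [seq F k | k <- r] <= T}.
      move=> _ /mapP[k _ ->]; rewrite in_fset_set // inE.
      by exists (b *+ k) => //; exact: subgroup_setMn.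
    by rewrite size_map size_iota ltnn.
  have [i [j [ij eqF]]] : exists i j, (i < j)%N /\ F i = F j.
    apply: contrapT => nex; move/negP: nuniq; apply.
    rewrite map_inj_in_uniq ?iota_uniq // => i j _ _ eqF.
    by case: (ltngtP i j) => // ij; exfalso; apply: nex; [exists i, j | exists j, i].
  exists (j - i)%N; rewrite subn_gt0 ij /=; apply/asboolP.
  by rewrite mulrnBr ?(ltnW ij) //; apply/(coset_set_eq _ _ sL).
case: (ex_minnP exk) => k /andP[k_gt0 /asboolP Lk] min_k.
have k_gt1 : (1 < k)%N.
  by case: k k_gt0 Lk {min_k} => [|[|k]] // _; rewrite mulr1n.
exists (b *+ (k %/ pdiv k)), (pdiv k); split.
- exact: pdiv_prime.
- exact: subgroup_setMn.
- move=> Lc; have := min_k (k %/ pdiv k)%N.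
  rewrite divn_gt0 ?pdiv_gt0 // pdiv_leq //=.
  move=> /(_ (introT (asboolP _) Lc)); rewrite leqNgt ltn_Pdiv //.
  exact/prime_gt1/pdiv_prime.
- by rewrite -mulrnA divnK ?pdiv_dvd.
Qed.

Local Notation evalQ a h := ((map_poly (ratr : rat -> algC) h).[a]).

Definition zspan (n : nat) (v : 'I_n -> algC) : set algC :=
  [set x | exists t : 'I_n -> int, x = \sum_i (t i)%:~R * v i].

Lemma zspan_subgroup n (v : 'I_n -> algC) : subgroup_set (zspan v).
Proof.
split; first by exists (fun=> 0); rewrite big1 // => i _; rewrite mul0r.
move=> _ _ [t ->] [t' ->]; exists (fun i => t i - t' i).
by rewrite -sumrB; apply: eq_bigr => i _; rewrite rmorphB mulrBl.
Qed.

Lemma zspan_mem n (v : 'I_n -> algC) i : zspan v (v i).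
Proof.
exists (fun j => (i == j)%:R); rewrite (bigD1 i) //= eqxx mul1r big1 ?addr0 //.
by move=> j; rewrite eq_sym => /negPf ->; rewrite mul0r.
Qed.

Lemma zspan_sub n (v : 'I_n -> algC) (A : set algC) : subgroup_set A ->
  (forall i, A (v i)) -> zspan v `<=` A.
Proof.
move=> sA Av _ [t ->]; apply: subgroup_set_sum => // i.
by rewrite mulrzl; exact: subgroup_setMz.
Qed.

Lemma subgroup_index_gt0 (G : zmodType) (B L : set G) : subgroup_set B ->
  finite_set (left_cosets B L) -> (0 < subgroup_index B L)%N.
Proof.
move=> sB finL; rewrite /subgroup_index /set_size cardfs_gt0.
apply/fset0Pn; exists (coset_set L 0).
by rewrite in_fset_set // inE; exists 0 => //; exact: sB.1.
Qed.

Lemma subgroup_index_full (G : zmodType) (B L : set G) : subgroup_set B ->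
  subgroup_set L -> B `<=` L -> subgroup_index B L = 1%N.
Proof.
move=> sB sL BL; rewrite /subgroup_index /set_size.
have -> : left_cosets B L = [set coset_set L 0].
  apply/seteqP; split=> [_ [x Bx <-]|_ ->] /=.
    by apply/(coset_set_eq _ _ sL); rewrite subr0; exact: BL.
  by exists 0 => //; exact: sB.1.
by rewrite fset_set1 cardfs1.
Qed.

Definition elementary_row (n : nat) (j : 'I_n) (p : int) (s : 'I_n -> int) : 'M[int]_n :=
  \matrix_(k, i) if k == j then (if i == j then p else - s i) else (k == i)%:R.

Lemma det_elementary_row n (j : 'I_n) p s : \det (elementary_row j p s) = p.
Proof.
rewrite (expand_det_col _ j) (bigD1 j) //= mxE !eqxx big1 => [|k /negPf kj]; last first.
  by rewrite mxE kj mul0r.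
rewrite addr0 /cofactor addnn -signr_odd odd_double expr0 mul1r.
rewrite (_ : row' _ _ = 1%:M) ?det1 ?mulr1 //.
apply/matrixP => a b; rewrite !mxE (inj_eq lift_inj).
by rewrite [lift j a == j]eq_sym (negPf (neq_lift j a)).
Qed.

Lemma coprime_subgroup (A : set algC) (x : algC) (a b : int) : subgroup_set A ->
  coprimez a b -> A (x *~ a) -> A (x *~ b) -> A x.
Proof.
move=> sA /coprimezP[[u w] /= e] Aa Ab; rewrite -[x]mulr1z -e mulrzDr.
by apply: subgroup_setD => //; rewrite mulrC mulrzA; exact: subgroup_setMz.
Qed.

Lemma lattice_basis n (alpha : algC) (B : set algC) (N : nat) (h : 'I_n -> {poly rat}) :
  subgroup_set B -> (forall j, B (evalQ alpha (h j))) ->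
  finite_set (left_cosets B (zspan (fun j => evalQ alpha (h j)))) ->
  subgroup_index B (zspan (fun j => evalQ alpha (h j))) = N ->
  exists h' : 'I_n -> {poly rat}, exists A : 'M[int]_n,
    [/\ forall j, B (evalQ alpha (h' j)), `|\det A|%N = N &
        forall j, h j = \sum_i (A j i)%:~R *: h' i].
Proof.
move=> sB; have [m] := ubnP N; elim: m => // m IHm in N h *; rewrite ltnS => Nm Bh.
set v := fun j => evalQ alpha (h j); set L := zspan v => finL indL.
have sL : subgroup_set L := zspan_subgroup v.
have LB : L `<=` B by exact: zspan_sub.
have [BL|] := pselect (B `<=` L).
  exists h, 1%:M; split=> // [|j]; first by rewrite det1 -indL subgroup_index_full.
  rewrite (bigD1 j) //= mxE eqxx scale1r big1 ?addr0 // => i.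
  by rewrite eq_sym mxE => /negPf ->; rewrite scale0r.
move=> /existsNP[b0 /not_implyP[Bb0 Lb0]].
have [c [p [p_pr Bc Lc [t eqt]]]] := exists_prime_order sB sL finL Bb0 Lb0.
have p0 : (p%:R : algC) != 0 by rewrite pnatr_eq0 -lt0n prime_gt0.
have [j ptj] : exists j, ~~ (p %| t j)%Z.
  apply: contrapT => nex; apply: Lc; exists (fun i => t i %/ p)%Z.
  apply: (mulfI p0); rewrite mulr_natl eqt mulr_sumr; apply: eq_bigr => i _.
  have /dvdzP[q eq] : (p %| t i)%Z.
    by apply: contrapT => /negP pti; apply: nex; exists i.
  rewrite eq mulzK ?intr_eq0; last by rewrite -lt0n prime_gt0.
  by rewrite rmorphM /= -pmulrn; ring.
have cop : coprimez (t j) p.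
  by rewrite coprimezE absz_nat coprime_sym prime_coprime // -dvdzE.
have /coprimezP[[u w] /= euw] := cop.
pose s i := if i == j then 1 else u * t i.
pose b := (p%:R)^-1 * \sum_i (s i)%:~R * v i.
have ebp : b *+ p = \sum_i (s i)%:~R * v i by rewrite -mulr_natl /b mulVKf.
have eb : b = c *~ u + v j *~ w.
  apply: (mulfI p0); rewrite mulr_natl ebp -(mulrzr c) -(mulrzr (v j)) mulrDr.
  rewrite (mulrA _ c) (mulr_natl c) eqt mulr_suml (bigD1 j) //= [in RHS](bigD1 j) //=.
  rewrite [X in _ + X = _](eq_bigr (fun i => (t i)%:~R * v i * u%:~R)); last first.
    by move=> i /negPf ij; rewrite /s ij rmorphM /=; ring.
  rewrite {1}/s eqxx -[in LHS]euw rmorphD !rmorphM /= -pmulrn; ring.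
have Bb : B b.
  by rewrite eb; apply: (subgroup_setD sB); apply: (subgroup_setMz sB) => //; exact: Bh.
have Lpb : L (b *+ p) by exists s.
have Lb : ~ L b.
  rewrite eb => Lb; apply: Lc; apply: (@coprime_subgroup L c u p) => //.
  - by apply/coprimezP; exists (t j, w); rewrite /= mulrC -euw mulrC.
  - rewrite -(addrK (v j *~ w) (c *~ u)); apply: sL.2 => //.
    by apply: (subgroup_setMz sL); exact: zspan_mem.
  - by exists t.
have Lib i : (0 < i < p)%N -> ~ L (b *+ i).
  move=> /andP[i0 ip] Li; apply: Lb; apply: (@coprime_subgroup L b i p) => //.
  by rewrite coprimezE !absz_nat coprime_sym prime_coprime // gtnNdvd.
pose h' i := if i == j then (p%:R)^-1 *: \sum_k (s k)%:~R *: h k else h i.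
pose v' i := evalQ alpha (h' i).
have ev' i : v' i = if i == j then b else v i.
  rewrite /v' /h'; case: eqP => // _.
  rewrite map_polyZ /= hornerZ fmorphV rmorph_nat; congr (_ * _).
  rewrite rmorph_sum horner_sum; apply: eq_bigr => k _.
  by rewrite /= map_polyZ hornerZ rmorph_int.
have ev : v j = b *+ p + \sum_(k | k != j) (- s k)%:~R * v' k.
  rewrite ebp (bigD1 j) //= /s eqxx mul1r -addrA -big_split /= big1 ?addr0 //.
  by move=> k kj; rewrite ev' (negPf kj) rmorphN mulNr subrr.
have eqL' : zspan v' = [set x | exists i : nat, L (x - b *+ i)].
  have sL' : subgroup_set [set x | exists i : nat, L (x - b *+ i)].
    by apply: (@extension_subgroup _ _ _ p) => //; exact: prime_gt0.
  apply/seteqP; split.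
    apply: zspan_sub => // i; rewrite ev'; case: eqP => _.
      by exists 1%N; rewrite subrr; exact: sL.1.
    by exists 0%N; rewrite subr0; exact: zspan_mem.
  have sv' := zspan_subgroup v'.
  have v'b : zspan v' b by have := zspan_mem v' j; rewrite ev' eqxx.
  move=> x [i Lx]; rewrite -(subrK (b *+ i) x).
  apply: (subgroup_setD sv'); last exact: subgroup_setMn.
  apply: (@zspan_sub _ v (zspan v')) Lx => // k.
  have [->|kj] := eqVneq k j; last first.
    by have := zspan_mem v' k; rewrite ev' (negPf kj).
  rewrite ev; apply: (subgroup_setD sv'); first exact: subgroup_setMn.
  apply: subgroup_set_sum => // l; rewrite mulrzl; apply: (subgroup_setMz sv').
  exact: zspan_mem.
have finL' : finite_set (left_cosets B (zspan v')).
  by rewrite eqL'; apply: (@extension_finite _ _ _ _ p) => //; exact: prime_gt0.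
have indL' : N = (p * subgroup_index B (zspan v'))%N.
  by rewrite -indL eqL'; apply: subgroup_index_extension => //; exact: prime_gt0.
have [||h'' [A [Bh'' dA eA]]] := IHm (subgroup_index B (zspan v')) h' _ _ finL' erefl.
- rewrite (leq_trans _ Nm) // indL' ltn_Pmull ?prime_gt1 //.
  exact: subgroup_index_gt0.
- move=> k; have := ev' k; rewrite /v' => ->.
  by case: eqP => // _; exact: Bh.
exists h'', (elementary_row j p s *m A); split=> // [|k].
  by rewrite det_mulmx det_elementary_row abszM dA indL'.
transitivity (\sum_i ((elementary_row j p s) k i)%:~R *: h' i).
  have [->|kj] := eqVneq k j; last first.
    rewrite (bigD1 k) //= mxE (negPf kj) eqxx scale1r big1 ?addr0 /h' ?(negPf kj) //.
    by move=> i; rewrite mxE (negPf kj) eq_sym => /negPf ->; rewrite scale0r.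
  rewrite (bigD1 j) //= mxE !eqxx {1}/h' eqxx scalerA.
  rewrite -pmulrn mulfV ?scale1r; last by rewrite pnatr_eq0 -lt0n prime_gt0.
  rewrite (bigD1 j) //= {1}/s eqxx scale1r -addrA -big_split /= big1 ?addr0 //.
  by move=> k' kj; rewrite mxE eqxx /h' (negPf kj) rmorphN scaleNr subrr.
transitivity (\sum_i \sum_l ((elementary_row j p s) k i)%:~R *: ((A i l)%:~R *: h'' l)).
  by apply: eq_bigr => i _; rewrite -scaler_sumr; congr (_ *: _); exact: eA.
rewrite exchange_big; apply: eq_bigr => i _ /=.
rewrite mxE rmorph_sum scaler_suml; apply: eq_bigr => l _.
by rewrite scalerA rmorphM.
Qed.

(** * The index of a monic irreducible polynomial *)

Lemma map_ratr_intr (p : {poly int}) :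
  map_poly (ratr : rat -> algC) (map_poly intr p) = map_poly intr p.
Proof. by rewrite -map_poly_comp; apply: eq_map_poly => b; rewrite /= ratr_int. Qed.

Lemma size_map_intr (F : numDomainType) (p : {poly int}) :
  size (map_poly intr p : {poly F}) = size p.
Proof. by rewrite size_map_inj_poly ?rmorph0 //; exact: intr_inj. Qed.

Lemma monic_map_intr (F : numDomainType) (p : {poly int}) :
  ((map_poly intr p : {poly F}) \is monic) = (p \is monic).
Proof.
rewrite !monicE lead_coef_map_inj ?rmorph0 //; last exact: intr_inj.
by rewrite -[X in _ == X](rmorph1 (intr : int -> F)) (inj_eq (@intr_inj _)).
Qed.

Lemma integralOver_intrP (x : algC) : integralOver (intr : int -> algC) x <-> x \in Aint.
Proof.
split=> [[p p_mon px]|xA].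
  apply: (root_monic_Aint px); first by rewrite monic_map_intr.
  by apply/polyOverP => i; rewrite coef_map /= rpred_int.
have /floorpP[p Dp] : minCpoly x \is a polyOver Num.int by [].
exists p; last by rewrite -Dp root_minCpoly.
by have := minCpoly_monic x; rewrite Dp monic_map_intr.
Qed.

Lemma irreducible_elt_dvdp (f : {poly int}) (a : algC) (q : {poly rat}) :
  f \is monic -> irreducible_elt f -> root (map_poly intr f) a ->
  root (map_poly ratr q) a -> (map_poly intr f : {poly rat}) %| q.
Proof.
move=> f_mon [_ _ f_irr] fa qa.
have aA : a \in Aint by apply/integralOver_intrP; exists f.
have [p [Dp p_mon dv_p]] := minCpolyP a.
have [z Dz] : exists z : {poly int}, p = map_poly intr z.
  have /floorpP[z Dz] : minCpoly a \is a polyOver Num.int by [].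
  exists z; apply: (map_poly_inj (ratr : {rmorphism rat -> algC})).
  by rewrite map_ratr_intr -Dz Dp.
have z_mon : z \is monic.
  by move: p_mon; rewrite Dz monic_map_intr.
have : p %| map_poly intr f by rewrite -dv_p map_ratr_intr.
rewrite Dz dvdp_rat_int => /dvdpP_int[s].
rewrite zprimitive_monic // => fzs.
have sz_z : (1 < size z)%N.
  have := size_minCpoly a.
  by rewrite Dp Dz map_ratr_intr size_map_intr.
have /orP[] := f_irr _ _ fzs.
  by rewrite poly_unitE => /andP[/eqP sz1]; rewrite sz1 in sz_z.
rewrite poly_unitE => /andP[s1 _]; have [c c0 es] := size_poly1P _ s1.
rewrite fzs es mulrC mul_polyC map_polyZ /= dvdpZl ?intr_eq0 //.
by rewrite -Dz -dv_p.
Qed.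

Lemma conjugate_Aint (f : {poly int}) (a b : algC) (h : {poly rat}) :
  f \is monic -> irreducible_elt f -> root (map_poly intr f) a ->
  root (map_poly intr f) b -> evalQ a h \in Aint -> evalQ b h \in Aint.
Proof.
move=> f_mon f_irr fa fb /integralOver_intrP[g g_mon gha].
apply/integralOver_intrP; exists g => //.
have eq_comp c : (map_poly ratr (map_poly intr g \Po h)).[c] =
    (map_poly intr g).[evalQ c h].
  by rewrite map_comp_poly horner_comp map_ratr_intr.
have /(irreducible_elt_dvdp f_mon f_irr fa)/dvdpP[s eqs] :
  root (map_poly ratr (map_poly intr g \Po h)) a by rewrite /root eq_comp.
rewrite /root -eq_comp eqs rmorphM /= hornerM map_ratr_intr.
by rewrite (rootP fb) mulr0.
Qed.

Lemma det_Aint n (M : 'M[algC]_n) : (forall i j, M i j \in Aint) -> \det M \in Aint.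
Proof.
move=> MA; apply: rpred_sum => s _; apply: rpredM.
  by rewrite rpredX // rpredN.
by apply: rpred_prod.
Qed.

Lemma prod_deriv_roots n (a : 'I_n -> algC) :
  exists2 e, e \in Aint &
    \prod_i (\prod_j ('X - (a j)%:P))^`().[a i] =
    e * (\prod_(i < n) \prod_(j < n | (i < j)%N) (a j - a i)) ^+ 2.
Proof.
have deriv_at i : (\prod_j ('X - (a j)%:P))^`().[a i] = \prod_(j | j != i) (a i - a j).
  rewrite (bigD1 i) //= derivM derivXsubC mul1r hornerD hornerM hornerXsubC subrr.
  by rewrite mul0r addr0 horner_prod; apply: eq_bigr => j _; rewrite hornerXsubC.
exists (\prod_(i < n) \prod_(j < n | (i < j)%N) (-1)).
  by apply: rpred_prod => i _; apply: rpred_prod => j _; rewrite rpredN.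
under eq_bigr => i _ do rewrite deriv_at (bigID (fun j : 'I_n => (i < j)%N)) /=.
rewrite big_split /= expr2 mulrA; congr (_ * _).
  rewrite -big_split; apply: eq_bigr => i _ /=; rewrite -big_split.
  apply: eq_big => [j|j _] /=; last by rewrite mulN1r opprB.
  by rewrite -(inj_eq val_inj) /=; lia.
rewrite (exchange_big_dep xpredT) //=; apply: eq_bigr => i _.
apply: eq_bigl => j; rewrite -leqNgt leq_eqVlt -(inj_eq val_inj) /=; lia.
Qed.

Lemma adjoinQ_sub (a x y : algC) : adjoinQ a x -> adjoinQ a y -> adjoinQ a (x - y).
Proof.
have nz x' : adjoinQ a x' -> exists p q : {poly rat},
    x' = evalQ a p / evalQ a q /\ evalQ a q != 0.
  move=> [p [q ->]]; have [q0|q0] := eqVneq (evalQ a q) 0; last by exists p, q.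
  by exists 0, 1; rewrite q0 invr0 mulr0 rmorph0 horner0 mul0r rmorph1 hornerC oner_neq0.
move=> /nz[p [q [-> q0]]] /nz[p' [q' [-> q'0]]].
exists (p * q' - p' * q), (q * q').
by rewrite rmorphB !rmorphM /= hornerD hornerN !hornerM; field; rewrite ?q0 ?q'0.
Qed.

Lemma ring_of_integers_subgroup (a : algC) : subgroup_set (ring_of_integers (adjoinQ a)).
Proof.
split; first split.
- by exists 0, 1; rewrite rmorph0 horner0 mul0r.
- exact/integralOver_intrP.
move=> x y [Kx /integralOver_intrP Ax] [Ky /integralOver_intrP Ay]; split.
  exact: adjoinQ_sub.
by apply/integralOver_intrP; rewrite rpredB.
Qed.

Lemma adjoinZ_zspan (f : {poly int}) n (a : algC) : f \is monic -> size f = n.+1 ->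
  root (map_poly intr f) a ->
  adjoinZ a = zspan (fun j : 'I_n => evalQ a 'X^j).
Proof.
move=> f_mon sz_f fa; apply/seteqP; split=> x.
  move=> [p _ <-]; rewrite (Pdiv.RingMonic.rdivp_eq f_mon p).
  rewrite rmorphD rmorphM /= hornerD hornerM (rootP fa) mulr0 add0r.
  set r := Pdiv.Ring.rmodp p f; exists (fun j => r`_j).
  have sz_r : (size r <= n)%N.
    by rewrite -ltnS -sz_f Pdiv.Ring.ltn_rmodpN0 // monic_neq0.
  rewrite (horner_coef_wide _ (leq_trans (size_poly _ _) sz_r)).
  by apply: eq_bigr => j _; rewrite coef_map map_polyXn hornerXn.
move=> [t ->]; exists (\poly_(i < n) oapp t 0 (insub i)) => //.
rewrite (horner_coef_wide _ (leq_trans (size_poly _ _) (size_poly _ _))).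
by apply: eq_bigr => j _; rewrite coef_map coef_poly ltn_ord map_polyXn hornerXn valK.
Qed.

Lemma prod_deriv_index (f : {poly int}) n (a : 'I_n -> algC) :
  (0 < n)%N -> f \is monic -> irreducible_elt f -> size f = n.+1 -> (0 < poly_index f)%N ->
  map_poly intr f = \prod_i ('X - (a i)%:P) ->
  exists2 w, w \in Aint &
    \prod_i (map_poly intr f)^`().[a i] = (poly_index f)%:R ^+ 2 * w.
Proof.
move=> n_gt0 f_mon f_irr sz_f ind_gt0 eq_f.
have fa i : root (map_poly intr f) (a i).
  by rewrite eq_f (bigD1 i) //= rootM root_XsubC eqxx.
have fal : root (map_poly intr f) (a_root f).
  have [x fx] : exists x : algC, root (map_poly intr f) x.
    by apply/closed_rootP; rewrite size_map_intr sz_f; case: (n) n_gt0.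
  by have := @xgetPex _ 0 [set al | root (map_poly intr f) al] (ex_intro _ x fx).
set al := a_root f in fal.
set B := ring_of_integers (adjoinQ al).
have sB : subgroup_set B := ring_of_integers_subgroup al.
have eqL := adjoinZ_zspan f_mon sz_f fal.
have alA : al \in Aint by apply/integralOver_intrP; exists f.
have BX (j : 'I_n) : B (evalQ al 'X^j).
  split; first by exists 'X^j, 1; rewrite rmorph1 hornerC divr1.
  by apply/integralOver_intrP; rewrite map_polyXn hornerXn rpredX.
have finL : finite_set (left_cosets B (zspan (fun j : 'I_n => evalQ al 'X^j))).
  apply: contrapT => infL; move: ind_gt0.
  by rewrite /poly_index /subgroup_index /set_size -/al -/B eqL /fset_set; case: pselect.
have indL : subgroup_index B (zspan (fun j : 'I_n => evalQ al 'X^j)) = poly_index f.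
  by rewrite -eqL.
have [h' [A [Bh' detA eqX]]] := lattice_basis sB BX finL indL.
have [e eA] := prod_deriv_roots a; rewrite -eq_f => ->.
pose M := \matrix_(i < n, k < n) evalQ (a k) (h' i).
exists (e * \det M ^+ 2).
  rewrite rpredM // rpredX // det_Aint // => i k; rewrite mxE.
  apply: (conjugate_Aint f_mon f_irr fal) => //.
  by apply/integralOver_intrP; exact: (Bh' i).2.
have eqV : Vandermonde n (\row_i a i) = map_mx intr A *m M.
  apply/matrixP => i k; rewrite !mxE -hornerXn -[LHS](_ : evalQ (a k) 'X^i = _); last first.
    by rewrite map_polyXn.
  rewrite eqX rmorph_sum horner_sum; apply: eq_bigr => l _.
  by rewrite !mxE /= map_polyZ hornerZ rmorph_int.
have := det_Vandermonde (\row_i a i); rewrite eqV det_mulmx det_map_mx.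
under [in RHS]eq_bigr => i _ do under eq_bigr => j _ do rewrite !mxE.
move=> <-; rewrite exprMn mulrCA; congr (_ * _).
have -> : (poly_index f)%:R = (`|\det A|%N)%:R :> algC by rewrite detA.
by rewrite -natrX -rmorphXn /= pmulrn; congr (_ %:~R); lia.
Qed.

(** * Dependence on the constant coefficient *)

Lemma closed_prod_XsubC (F : closedFieldType) (p : {poly F}) :
  exists a : 'I_(size p).-1 -> F, p = lead_coef p *: \prod_i ('X - (a i)%:P).
Proof.
have [r ep] := closed_field_poly_normal p.
have [->|p0] := eqVneq p 0; first by exists (fun=> 0); rewrite lead_coef0 scale0r.
have sz : size p = (size r).+1.
  by rewrite {1}ep size_scale ?lead_coef_eq0 // size_prod_XsubC.
exists (fun i => r`_i); rewrite {1}ep sz; congr (_ *: _).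
by rewrite (big_nth 0) big_mkord.
Qed.

Lemma discriminant_poly (g : {poly int}) (n : nat) :
  (0 < n)%N -> g \is monic -> size g = n.+1 ->
  exists P : {poly algC}, [/\ (size P <= n)%N, P`_n.-1 = (n ^ n)%N%:R &
    forall c : int, irreducible_elt (g + c%:P) -> (0 < poly_index (g + c%:P))%N ->
      exists2 w, w \in Aint & P.[c%:~R] = (poly_index (g + c%:P))%:R ^+ 2 * w].
Proof.
move=> n_gt0 g_mon sz_g; set G : {poly algC} := map_poly intr g.
have sz_G : size G = n.+1 by rewrite size_map_intr.
have coefG : G`_n = 1.
  by rewrite -[n]/(n.+1.-1) -sz_G -lead_coefE; apply/monicP; rewrite monic_map_intr.
have coefG' : G^`()`_n.-1 = n%:R by rewrite coef_deriv prednK // coefG.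
have sz_G' : (size G^`()).-1 = n.-1.
  suff -> : size G^`() = n by [].
  apply/eqP; rewrite eqn_leq; apply/andP; split.
    by rewrite -ltnS -sz_G lt_size_deriv // -size_poly_gt0 sz_G.
  rewrite leqNgt; apply: contraTN n_gt0 => sz; rewrite -eqn0Ngt.
  have : G^`()`_n.-1 = 0 by apply: nth_default; case: (n) sz.
  by rewrite coefG' => /eqP; rewrite pnatr_eq0 => n0; rewrite n0.
have [ga eG'] := closed_prod_XsubC G^`().
move: ga eG'; rewrite sz_G' lead_coefE sz_G' coefG' => ga eG'.
pose P : {poly algC} := (n ^ n)%N%:R *: \prod_j ('X - (- G.[ga j])%:P).
have sz_prod : size (\prod_j ('X - (- G.[ga j])%:P)) = n.
  by rewrite -big_enum size_prod_XsubC -cardE card_ord prednK.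
exists P; split.
- by rewrite (leq_trans (size_scale_leq _ _)) // sz_prod.
- have := monic_prod_XsubC (index_enum 'I_n.-1) xpredT (fun j => - G.[ga j]).
  by rewrite monicE lead_coefE sz_prod coefZ => /eqP ->; rewrite mulr1.
move=> c f_irr ind_gt0; set f := g + c%:P in f_irr ind_gt0 *.
have sz_c : (size c%:P < size g)%N by rewrite sz_g ltnS (leq_trans (size_polyC_leq1 _)).
have sz_f : size f = n.+1 by rewrite /f size_polyDl.
have f_mon : f \is monic by rewrite monicE /f lead_coefDl // -monicE.
have eqF : map_poly intr f = G + (c%:~R)%:P :> {poly algC}.
  by rewrite rmorphD /= map_polyC.
have [a] := closed_prod_XsubC (map_poly intr f : {poly algC}).
move: a; rewrite size_map_intr sz_f /= => a.
have /monicP -> : (map_poly intr f : {poly algC}) \is monic by rewrite monic_map_intr.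
rewrite scale1r => eq_f.
have [w wA ew] := prod_deriv_index n_gt0 f_mon f_irr sz_f ind_gt0 eq_f.
exists w => //; rewrite -{}ew.
rewrite hornerZ horner_prod eqF derivD derivC addr0.
under [RHS]eq_bigr => i _ do rewrite eG' hornerZ horner_prod.
rewrite big_split /= prodr_const card_ord natrX; congr (_ * _).
rewrite [LHS](eq_bigr (fun j => (-1) ^+ n * \prod_i (a i - ga j))); last first.
  move=> j _; rewrite hornerXsubC opprK addrC.
  have -> : G.[ga j] + c%:~R = (map_poly intr f : {poly algC}).[ga j].
    by rewrite eqF hornerD hornerC.
  rewrite eq_f horner_prod -[n in (-1) ^+ n](card_ord n) -prodrN.
  by apply: eq_bigr => i _; rewrite hornerXsubC opprB.
rewrite big_split /= prodr_const card_ord -exprM -signr_odd.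
have -> : odd (n * n.-1) = false by rewrite oddM; case: (n) n_gt0 => //= m _; case: odd.
rewrite expr0 mul1r exchange_big; apply: eq_bigr => i _ /=.
by apply: eq_bigr => j _; rewrite hornerXsubC.
Qed.

Lemma lagrange_lead_coef (F : fieldType) (n : nat) (x : 'I_n -> F) (P : {poly F}) :
  injective x -> (size P <= n)%N ->
  P`_n.-1 = \sum_i P.[x i] / \prod_(j | j != i) (x i - x j).
Proof.
move=> x_inj sz_P; set D := fun i => \prod_(j | j != i) (x i - x j).
have D0 i : D i != 0.
  by apply/prodf_neq0 => j ji; rewrite subr_eq0 (inj_eq x_inj) eq_sym.
pose b i : {poly F} := \prod_(j | j != i) ('X - (x j)%:P).
have sz_b i : size (b i) = n.
  have -> : b i = \prod_(j <- enum (predC1 i)) ('X - (x j)%:P) by rewrite big_enum.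
  by rewrite size_prod_XsubC -cardE cardC1 card_ord prednK //; case: (n) i => // -[].
pose Q := \sum_i (P.[x i] / D i) *: b i.
have eqPQ : P = Q.
  apply/eqP; rewrite -subr_eq0; apply/negPn/negP => PQ0.
  have : (size (P - Q)%R <= n)%N.
    rewrite (leq_trans (size_polyD _ _)) // size_polyN geq_max sz_P /=.
    rewrite (leq_trans (size_sum _ _ _)) //; apply/bigmax_leqP => i _.
    by rewrite (leq_trans (size_scale_leq _ _)) // sz_b.
  apply/negP; rewrite -ltnNge.
  have := max_poly_roots (rs := map x (enum 'I_n)) PQ0.
  rewrite size_map -cardE card_ord; apply.
    apply/allP => _ /mapP[i _ ->]; rewrite rootE hornerD hornerN horner_sum.
    rewrite (bigD1 i) //= big1 ?addr0 => [|j ji].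
      rewrite hornerZ horner_prod (eq_bigr (fun j => x i - x j)).
        by rewrite divfK // subrr.
      by move=> j _; rewrite hornerXsubC.
    by rewrite hornerZ horner_prod (bigD1 i) 1?eq_sym //= hornerXsubC subrr mul0r mulr0.
  by rewrite map_inj_uniq ?enum_uniq.
rewrite {1}eqPQ coef_sum; apply: eq_bigr => i _; rewrite coefZ.
have : lead_coef (b i) = 1 by apply/monicP; exact: monic_prod_XsubC.
by rewrite lead_coefE sz_b => ->; rewrite mulr1.
Qed.

Lemma logn_prod_leq (I : finType) (A : pred I) (F : I -> nat) (p b : nat) :
  prime p -> (forall i, A i -> (0 < F i)%N && (logn p (F i) <= b)%N) ->
  (logn p (\prod_(i | A i) F i) <= #|A| * b)%N.
Proof.
move=> p_pr hF; rewrite -sum_nat_const.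
suff : (0 < \prod_(i | A i) F i)%N && (logn p (\prod_(i | A i) F i) <= \sum_(i | A i) b)%N.
  by case/andP.
elim/big_rec2: _ => [|i m s Ai /andP[s0 ls]]; first by rewrite logn1.
have /andP[F0 lF] := hF i Ai.
by rewrite muln_gt0 F0 s0 lognM // leq_add.
Qed.

(* Lagrange interpolation writes L as a sum of the P(c_i) / prod_(j != i) (c_i - c_j); the
   p-adic valuation of each denominator is at most (n - 1)(e - 1). *)
Lemma lagrange_padic (n : nat) (c : 'I_n -> int) (P : {poly algC}) (L p k e : nat) :
  prime p -> (0 < n)%N -> (0 < L)%N -> (size P <= n)%N -> P`_n.-1 = L%:R ->
  (forall i j, i != j -> ~~ ((p ^ e.+1)%N %| c i - c j)%Z) ->
  (forall i, exists2 w, w \in Aint & P.[(c i)%:~R] = (p ^ k)%N%:R * w) ->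
  (k <= n.-1 * e + logn p L)%N.
Proof.
move=> p_pr n_gt0 L_gt0 sz_P lead_P ncong Pdiv.
have /fin_all_exists[w /all_and2[wA ew]] : forall i, exists w,
    w \in Aint /\ P.[(c i)%:~R] = (p ^ k)%N%:R * w.
  by move=> i; have [w wA ew] := Pdiv i; exists w.
have c_neq i j : i != j -> c i - c j != 0.
  by move=> ij; apply: contraNneq (ncong i j ij) => ->; rewrite dvdz0.
have c_inj : injective (fun i => (c i)%:~R : algC).
  move=> i j /intr_inj cij; apply/eqP; apply: contraT => /c_neq.
  by rewrite cij subrr eqxx.
pose D i := \prod_(j | j != i) (c i - c j).
have absD i : `|D i|%N = (\prod_(j | j != i) `|c i - c j|)%N.
  by rewrite /D (big_morph absz abszM absz1).
have D_gt0 i : (0 < `|D i|)%N.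
  by rewrite absz_gt0; apply/prodf_neq0 => j ji; rewrite c_neq // eq_sym.
have logD i : (logn p `|D i| <= n.-1 * e)%N.
  rewrite absD; have -> : n.-1 = #|(fun j : 'I_n => j != i)|.
    by rewrite -[in LHS](card_ord n) -(cardC1 i); apply: eq_card.
  apply: logn_prod_leq => // j ji; rewrite absz_gt0 c_neq 1?eq_sym //=.
  have := ncong i j; rewrite eq_sym => /(_ ji).
  by rewrite dvdzE absz_nat pfactor_dvdn ?absz_gt0 ?c_neq 1?eq_sym // -ltnNge ltnS.
pose U := ((\prod_i `|D i|%N)%N`_p^')%N.
have prodD_gt0 : (0 < \prod_i `|D i|)%N by apply: prodn_gt0.
have dvdDU i : (`|D i| %| U * p ^ (n.-1 * e))%N.
  rewrite -[X in (X %| _)%N](partnC p) // mulnC dvdn_mul //.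
    by rewrite partn_dvd // (bigD1 i) //= dvdn_mulr.
  by rewrite p_part dvdn_exp2l.
have /fin_all_exists[q hq] : forall i, exists q : int, (U * p ^ (n.-1 * e))%N%:Z = q * D i.
  by move=> i; apply/dvdzP; rewrite dvdzE absz_nat.
have main : (L * (U * p ^ (n.-1 * e)))%N%:R = (p ^ k)%N%:R * \sum_i w i * (q i)%:~R :> algC.
  rewrite natrM -lead_P (lagrange_lead_coef c_inj sz_P) mulr_suml mulr_sumr.
  apply: eq_bigr => i _; rewrite pmulrn (hq i) rmorphM /= ew.
  have -> : \prod_(j | j != i) ((c i)%:~R - (c j)%:~R) = (D i)%:~R :> algC.
    by rewrite rmorph_prod; apply: eq_bigr => j _; rewrite rmorphB.
  have : (D i)%:~R != 0 :> algC by rewrite intr_eq0 -absz_gt0.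
  by move=> D0; field.
have pk0 : (p ^ k)%N%:R != 0 :> algC by rewrite pnatr_eq0 -lt0n expn_gt0 prime_gt0.
have /intrP[z ez] : \sum_i w i * (q i)%:~R \in Num.int.
  apply: Cint_rat_Aint; last by apply: rpred_sum => i _; rewrite rpredM // Aint_int.
  rewrite -[X in X \in _](mulKf pk0) -main.
  by rewrite rpredM ?rpredV ?rpred_nat.
have U_gt0 : (0 < U)%N by exact: part_gt0.
have cop : logn p U = 0%N.
  apply: logn_coprime; apply: (@pnat_coprime p); [exact: pnat_id | exact: part_pnat].
have : (p ^ k %| L * (U * p ^ (n.-1 * e)))%N.
  have : (L * (U * p ^ (n.-1 * e)))%N%:Z = (p ^ k)%N%:Z * z.
    by apply: (@intr_inj algC); rewrite [RHS]intrM -ez -!pmulrn main.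
  by move=> /(congr1 absz); rewrite abszM !absz_nat => ->; rewrite dvdn_mulr.
rewrite pfactor_dvdn ?muln_gt0 ?L_gt0 ?U_gt0 ?expn_gt0 ?prime_gt0 //.
have pe_gt0 : (0 < p ^ (n.-1 * e))%N by rewrite expn_gt0 prime_gt0.
by rewrite !lognM ?muln_gt0 ?U_gt0 ?pe_gt0 // [logn p U]cop pfactorK // add0n addnC.
Qed.

(** * Residue classes *)

Definition res_bound (S : set int) (q k : nat) : Prop :=
  forall s : seq int, (forall x, x \in s -> S x) ->
    (size (undup [seq (x %% q)%Z | x <- s]) <= k)%N.

Lemma modz_modM (x a b : int) : ((x %% (a * b))%Z %% a)%Z = (x %% a)%Z.
Proof. by rewrite [in RHS](intdiv.divz_eq x (a * b)) (mulrC a b) mulrA intdiv.modzMDl. Qed.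

Lemma res_bound_mul (S : set int) (a b k l : nat) : coprime a b ->
  res_bound S a k -> res_bound S b l -> res_bound S (a * b) (k * l).
Proof.
move=> cop Sa Sb s sS; set r := undup _.
have rP z : z \in r -> exists2 x, x \in s & z = (x %% (a * b)%N)%Z.
  by rewrite mem_undup => /mapP[x xs ->]; exists x.
pose g z := ((z %% a)%Z, (z %% b)%Z).
have g_inj : {in r &, injective g}.
  move=> _ _ /rP[x _ ->] /rP[y _ ->] [/eqP ea /eqP eb].
  move: ea eb; rewrite !eqz_mod_dvd => da db.
  suff : ((x %% (a * b)%N)%Z == (y %% (a * b)%N)%Z %[mod (a * b)%N])%Z.
    by rewrite !modz_mod => /eqP.
  by rewrite eqz_mod_dvd PoszM Gauss_dvdz ?da.
rewrite -(size_map g) (leq_trans _ (leq_mul (Sa s sS) (Sb s sS))) //.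
rewrite -(size_allpairs pair); apply: uniq_leq_size.
  by rewrite map_inj_in_uniq ?undup_uniq.
move=> _ /mapP[_ /rP[x xs ->] ->]; apply/allpairsP.
exists ((x %% a)%Z, (x %% b)%Z); split.
- by rewrite mem_undup; apply/mapP; exists x.
- by rewrite mem_undup; apply/mapP; exists x.
- by rewrite /g PoszM modz_modM mulrC modz_modM.
Qed.

Lemma coprime_prime_prod (p e : nat) (r : seq nat) (E : nat -> nat) :
  prime p -> all prime r -> p \notin r -> coprime (p ^ e) (\prod_(q <- r) q ^ E q).
Proof.
move=> p_pr; elim: r => [|q r IHr]; first by rewrite big_nil coprimen1.
rewrite big_cons inE negb_or /= => /andP[q_pr r_pr] /andP[pq pr].
rewrite coprimeMr IHr // andbT coprimeXl ?coprimeXr //.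
by rewrite prime_coprime // dvdn_prime2.
Qed.

Lemma res_bound_prod (S : set int) (k : nat) (r : seq nat) (E : nat -> nat) :
  all prime r -> uniq r -> (forall p, p \in r -> res_bound S (p ^ E p) k) ->
  res_bound S (\prod_(p <- r) p ^ E p) (k ^ size r).
Proof.
elim: r => [|p r IHr] /=.
  move=> _ _ _ s _; rewrite big_nil expn0.
  rewrite (@uniq_leq_size _ _ [:: 0]) ?undup_uniq // => x.
  by rewrite mem_undup => /mapP[y _ ->]; rewrite modz1 mem_head.
move=> /andP[p_pr r_pr] /andP[pr ur] hr; rewrite big_cons expnS.
apply: res_bound_mul; first exact: coprime_prime_prod.
  by apply: hr; rewrite mem_head.
by apply: IHr => // q qr; apply: hr; rewrite inE qr orbT.
Qed.

Lemma res_bound_interval (S : set int) (q k M : nat) (s : seq int) : (0 < q)%N ->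
  res_bound S q k -> uniq s -> (forall x, x \in s -> S x /\ (`|x| <= M)%N) ->
  (size s <= k * (2 * M %/ q).+1)%N.
Proof.
move=> q_gt0 Sq us sS; pose g x := ((x %% q)%Z, `|((x + M) %/ q)%Z|%N).
have quo x : x \in s -> ((x + M) %/ q)%Z = `|((x + M) %/ q)%Z|%N.
  move=> /sS[_ xM]; rewrite gez0_abs // divz_ge0 //; lia.
have g_inj : {in s &, injective g}.
  move=> x y xs ys [em /(congr1 Posz)]; rewrite -!quo // => ed.
  apply: (@addIr _ M%:Z); rewrite (intdiv.divz_eq (x + M) q) (intdiv.divz_eq (y + M) q) ed.
  by congr (_ + _); rewrite -modzDml em modzDml.
rewrite -(size_map g).
apply: (@leq_trans (size [seq (u, v) | u <- undup [seq (x %% q)%Z | x <- s],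
    v <- iota 0 (2 * M %/ q).+1])).
  apply: uniq_leq_size; first by rewrite map_inj_in_uniq.
  move=> _ /mapP[x xs ->]; apply/allpairsP; exists (g x); split => //.
    by rewrite mem_undup; apply/mapP; exists x.
  have : (`|((x + M) %/ q)%Z|%N <= 2 * M %/ q)%N.
    rewrite -lez_nat -quo // -divz_nat.
    by apply: intdiv.lez_pdiv2r => //; have [_] := sS x xs; lia.
  by rewrite /g mem_iota add0n ltnS.
by rewrite size_allpairs size_iota leq_mul2r Sq ?orbT // => x /sS[].
Qed.

Lemma res_bound_padic (n : nat) (P : {poly algC}) (L p e : nat) (S : set int) :
  prime p -> (0 < n)%N -> (0 < L)%N -> (size P <= n)%N -> P`_n.-1 = L%:R ->
  (forall c, S c -> exists k, (n.-1 * e + logn p L < k)%N /\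
      exists2 w, w \in Aint & P.[c%:~R] = (p ^ k)%N%:R * w) ->
  res_bound S (p ^ e.+1) n.-1.
Proof.
move=> p_pr n_gt0 L_gt0 sz_P lead_P Sdiv s sS; rewrite leqNgt prednK //.
set f := fun x : int => (x %% (p ^ e.+1)%N)%Z; set r := undup _; apply/negP => nr.
pose c (i : 'I_n) : int := s`_(index r`_i [seq f x | x <- s]).
have ri (i : 'I_n) : r`_i \in [seq f x | x <- s].
  by rewrite -mem_undup mem_nth // (leq_trans _ nr) // ltnS ltnW.
have fc i : f (c i) = r`_i.
  by rewrite /c -(nth_map 0 0) -?index_mem ?nth_index // -(size_map f) index_mem.
have cs i : c i \in s by rewrite mem_nth // -(size_map f) index_mem.
suff : ((n.-1 * e + logn p L).+1 <= n.-1 * e + logn p L)%N by rewrite ltnn.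
apply: (@lagrange_padic n c P) => // [i j ij|i].
  rewrite -eqz_mod_dvd -/(f (c i)) -/(f (c j)) !fc nth_uniq ?undup_uniq //.
  - by rewrite (leq_trans _ nr).
  - by rewrite (leq_trans _ nr).
have [k [kb [w wA ew]]] := Sdiv _ (sS _ (cs i)).
exists ((p ^ (k - (n.-1 * e + logn p L).+1))%N%:R * w).
  by rewrite rpredM // Aint_Cnat ?natr_nat.
by rewrite ew mulrA -natrM -expnD subnKC.
Qed.

(** * Choice of the modulus *)

Lemma prodn_expl (I : Type) (r : seq I) (F : I -> nat) (k : nat) :
  (\prod_(i <- r) F i ^ k = (\prod_(i <- r) F i) ^ k)%N.
Proof. by rewrite (big_morph (expn^~ k) (fun x y => expnMn x y k) (exp1n k)). Qed.

Lemma prod_primes_logn (m : nat) : (0 < m)%N ->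
  (\prod_(p <- primes m) p ^ logn p m = m)%N.
Proof.
by move=> m_gt0; rewrite [RHS]prod_prime_decomp // prime_decompE big_map.
Qed.

Lemma logn_prime_prod (q : nat) (r : seq nat) (E : nat -> nat) :
  prime q -> all prime r -> uniq r ->
  logn q (\prod_(p <- r) p ^ E p)%N = if q \in r then E q else 0%N.
Proof.
move=> q_pr; elim: r => [|p r IHr] /=; first by rewrite big_nil logn1.
move=> /andP[p_pr r_pr] /andP[pr ur].
have prod_gt0 : (0 < \prod_(p <- r) p ^ E p)%N.
  by rewrite big_seq; apply: prodn_cond_gt0 => i /(allP r_pr) i_pr; rewrite expn_gt0 prime_gt0.
have p_gt0 : (0 < p ^ E p)%N by rewrite expn_gt0 prime_gt0.
rewrite big_cons lognM // (IHr r_pr ur) lognX logn_prime // inE.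
by case: (eqVneq q p) => [->|_] /=; rewrite ?(negPf pr) ?muln1 ?addn0 ?muln0.
Qed.

Lemma prime_prod_logn_dvdn (r : seq nat) (m : nat) : all prime r -> uniq r ->
  (\prod_(p <- r) p ^ logn p m %| m)%N.
Proof.
elim: r => [|p r IHr] /=; first by rewrite big_nil dvd1n.
move=> /andP[p_pr r_pr] /andP[pr ur]; rewrite big_cons Gauss_dvd.
  by rewrite pfactor_dvdnn IHr.
exact: coprime_prime_prod.
Qed.

(* The exponent of p in Y is the largest e with (n - 1)(2e - 1) + v_p(n^n) < 2 v_p(N), the range
   in which N^2 | P(c) confines c to n - 1 classes modulo p^(2e). *)
Definition admissible (n N Y : nat) : Prop :=
  forall p, prime p -> (p %| Y)%N ->
    (p %| N)%N /\ (n.-1 * (2 * logn p Y).-1 + logn p (n ^ n) < 2 * logn p N)%N.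

Lemma admissible_dvdn n N Y d : (0 < Y)%N -> admissible n N Y -> (d %| Y)%N ->
  admissible n N d.
Proof.
move=> Y_gt0 adm dY p p_pr pd; have [pN hp] := adm p p_pr (dvdn_trans pd dY).
split=> //; apply: leq_ltn_trans hp; rewrite leq_add2r leq_mul2l; apply/orP; right.
by have := dvdn_leq_log p Y_gt0 dY; lia.
Qed.

Lemma exists_admissible n N : (1 < n)%N -> (0 < N)%N ->
  exists Y, [/\ (0 < Y)%N, admissible n N Y &
    (N ^ 2 <= Y ^ (2 * n.-1) * rad_nat N ^ n.-1 * n ^ n)%N].
Proof.
move=> n_gt1 N_gt0; have r_pr : all prime (primes N).
  by apply/allP => p; rewrite mem_primes => /andP[].
have r_uniq := primes_uniq N.
pose E p := ((2 * logn p N + n.-2 - logn p (n ^ n)) %/ (2 * n.-1))%N.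
have d_gt0 : (0 < 2 * n.-1)%N by lia.
have E_le p : (E p * (2 * n.-1) <= 2 * logn p N + n.-2 - logn p (n ^ n))%N.
  exact: leq_divM.
have E_gt p : (2 * logn p N + n.-2 - logn p (n ^ n) < (E p).+1 * (2 * n.-1))%N.
  exact: ltn_ceil.
exists (\prod_(p <- primes N) p ^ E p)%N; split.
- rewrite big_seq; apply: prodn_cond_gt0 => p /(allP r_pr) p_pr.
  by rewrite expn_gt0 prime_gt0.
- move=> p p_pr pY.
  have : (0 < logn p (\prod_(p <- primes N) p ^ E p))%N.
    rewrite logn_gt0 mem_primes p_pr pY andbT /= big_seq.
    by apply: prodn_cond_gt0 => q /(allP r_pr) q_pr; rewrite expn_gt0 prime_gt0.
  rewrite logn_prime_prod //; case: ifP => // pN Ep.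
  split; first by move: pN; rewrite mem_primes => /and3P[].
  have := E_le p; case: (E p) Ep => // e _ ; nia.
- rewrite /rad_nat -!mulnA.
  apply: (@leq_trans (\prod_(p <- primes N) (p ^ (E p * (2 * n.-1)) *
      (p ^ n.-1 * p ^ logn p (n ^ n))))); last first.
    rewrite big_split leq_mul //.
      by under eq_bigr => p _ do rewrite expnM; rewrite prodn_expl.
    rewrite big_split leq_mul //; first by rewrite prodn_expl.
    by apply: dvdn_leq; [rewrite expn_gt0; lia | exact: prime_prod_logn_dvdn].
  rewrite -[in X in (X <= _)%N](prod_primes_logn N_gt0) -prodn_expl big_seq [X in (_ <= X)%N]big_seq.
  apply: leq_prod => p /(allP r_pr) p_pr; rewrite -expnM -!expnD leq_exp2l ?prime_gt1 //.
  have := E_gt p; nia.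
Qed.

Lemma minimal_divisor (T : pred nat) (Y : nat) : (0 < Y)%N -> T Y ->
  exists d, [/\ (d %| Y)%N, T d &
    d = 1%N \/ exists p, [/\ prime p, (p %| d)%N & ~~ T (d %/ p)%N]].
Proof.
move=> Y_gt0 TY; have exd : exists d, (d %| Y)%N && T d by exists Y; rewrite dvdnn.
case: (ex_minnP exd) => d /andP[dY Td] min_d; exists d; split=> //.
have d_gt0 : (0 < d)%N := dvdn_gt0 Y_gt0 dY.
have [->|d1] := eqVneq d 1%N; [by left | right].
have p_pr : prime (pdiv d) by apply: pdiv_prime; lia.
exists (pdiv d); split; rewrite ?pdiv_dvd //.
apply/negP => Td'; have := min_d (d %/ pdiv d)%N; rewrite Td' andbT.
rewrite (dvdn_trans _ dY); last first.
  by apply/dvdnP; exists (pdiv d); rewrite mulnC divnK ?pdiv_dvd.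
by move=> /(_ isT); rewrite leqNgt ltn_Pdiv ?prime_gt1.
Qed.

Lemma res_bound_admissible (n Y : nat) (P : {poly algC}) (S : set int) :
  (1 < n)%N -> (0 < Y)%N -> (size P <= n)%N -> P`_n.-1 = (n ^ n)%N%:R ->
  (forall c, S c -> exists N, [/\ (0 < N)%N, admissible n N Y &
      exists2 w, w \in Aint & P.[c%:~R] = N%:R ^+ 2 * w]) ->
  res_bound S (Y ^ 2) (n.-1 ^ size (primes Y)).
Proof.
move=> n_gt1 Y_gt0 sz_P lead_P Sadm.
have r_pr : all prime (primes Y) by apply/allP => p; rewrite mem_primes => /andP[].
have -> : (Y ^ 2 = \prod_(p <- primes Y) p ^ (2 * logn p Y))%N.
  rewrite -{1}(prod_primes_logn Y_gt0) -prodn_expl.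
  by apply: eq_bigr => p _; rewrite -expnM mulnC.
apply: res_bound_prod => //; first exact: primes_uniq.
move=> p; rewrite mem_primes => /and3P[p_pr _ pY].
have log_gt0 : (0 < logn p Y)%N by rewrite logn_gt0 mem_primes p_pr Y_gt0.
have -> : (2 * logn p Y = (2 * logn p Y).-1.+1)%N by lia.
apply: (@res_bound_padic n P (n ^ n)) => //; [lia | by rewrite expn_gt0; lia | ].
move=> c /Sadm[N [N_gt0 /(_ p p_pr pY)[_ hp] [w wA ew]]].
exists (2 * logn p N)%N; split=> //.
exists ((N ^ 2 %/ p ^ (2 * logn p N))%N%:R * w); first by rewrite rpredM // Aint_Cnat ?natr_nat.
by rewrite ew mulrA -natrM -natrX mulnC divnK // mulnC expnM dvdn_exp2r // pfactor_dvdnn.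
Qed.

(** * Counting *)

Lemma size_fibers (T : Type) (K : eqType) (g : T -> K) (r : seq K) (s : seq T) :
  all (fun x => g x \in r) s ->
  (size s <= \sum_(k <- r) size [seq x <- s | g x == k])%N.
Proof.
elim: s => //= x s IHs /andP[xr /IHs{}IHs].
rewrite (eq_bigr (fun k => (g x == k) + size [seq x <- s | g x == k])%N); last first.
  by move=> k _; case: ifP.
rewrite big_split -[X in (X <= _)%N]add1n leq_add //.
by rewrite (big_rem (g x)) //= eqxx.
Qed.

Lemma size_agree_fibers (T : eqType) (phi : nat -> T -> int) (M : nat -> nat) (B : nat)
    (r : seq nat) (X : T -> Prop) :
  (forall x i, X x -> i \in r -> (`|phi i x| <= M i)%N) ->
  (forall s, uniq s -> (forall x, x \in s -> X x) ->
    (forall i, i \in r -> {in s &, forall x y, phi i x = phi i y}) -> (size s <= B)%N) ->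
  forall s, uniq s -> (forall x, x \in s -> X x) ->
    (size s <= B * \prod_(i <- r) (2 * M i).+1)%N.
Proof.
elim: r X => [|i r IHr] X XM XB s us sX.
  by rewrite big_nil muln1; apply: XB.
rewrite big_cons mulnCA.
pose I := [seq k%:Z - (M i)%:Z | k <- iota 0 (2 * M i).+1].
have sI : all (fun x => phi i x \in I) s.
  apply/allP => x /sX Xx; have := XM x i Xx (mem_head _ _) => phiM.
  apply/mapP; exists `|(phi i x + (M i)%:Z)%R|%N; first by rewrite mem_iota; lia.
  by lia.
apply: leq_trans (size_fibers sI) _.
have -> : (2 * M i).+1 = size I by rewrite size_map size_iota.
rewrite -sum1_size big_distrl /=; apply: leq_sum => c _; rewrite mul1n.
apply: (IHr (fun x => X x /\ phi i x = c)).
- by move=> x j [Xx _] jr; apply: XM => //; rewrite inE jr orbT.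
- move=> t ut tX tr; apply: XB => // [x /tX[]//|j].
  rewrite inE => /orP[/eqP -> x y /tX[_ ->] /tX[_ ->] //|]; exact: tr.
- exact: filter_uniq.
- by move=> x; rewrite mem_filter => /andP[/eqP <- /sX].
Qed.

Lemma exp_size_primes_leq (L Y : nat) : (0 < L)%N -> (0 < Y)%N ->
  (L ^ size (primes Y) <= L ^ L * Y)%N.
Proof.
move=> L_gt0 Y_gt0.
have -> : (L ^ size (primes Y) = \prod_(p <- primes Y) L)%N.
  by rewrite big_const_seq count_predT -Monoid.iteropE.
rewrite (bigID (fun p => p < L)%N) /= leq_mul //.
  rewrite big_const_seq -Monoid.iteropE leq_pexp2l //.
  rewrite -size_filter -[X in (_ <= X)%N](size_iota 0 L).
  apply: uniq_leq_size; first by rewrite filter_uniq ?primes_uniq.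
  by move=> p; rewrite mem_filter mem_iota => /andP[].
apply: (@leq_trans (\prod_(p <- primes Y) p)); last first.
  rewrite -[X in (_ <= X)%N](prod_primes_logn Y_gt0) big_seq [X in (_ <= X)%N]big_seq.
  apply: leq_prod => p pY; rewrite -[X in (X <= _)%N]expn1 leq_exp2l.
    by rewrite logn_gt0.
  by apply: prime_gt1; move: pY; rewrite mem_primes => /andP[].
rewrite [X in (_ <= X)%N](bigID (fun p => p < L)%N) /= -[X in (X <= _)%N]mul1n.
rewrite leq_mul //.
  rewrite big_seq_cond; apply: prodn_cond_gt0 => p /andP[+ _].
  by rewrite mem_primes => /and3P[/prime_gt0].
by apply: leq_prod => p; rewrite -leqNgt.
Qed.

Lemma mem_primes_leq_rad (N p : nat) : prime p -> (0 < N)%N -> (p %| N)%N ->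
  (p <= rad_nat N)%N.
Proof.
move=> p_pr N_gt0 pN; have p_in : p \in primes N by rewrite mem_primes p_pr N_gt0.
apply: dvdn_leq; last by rewrite /rad_nat (big_rem p) //= dvdn_mulr.
rewrite /rad_nat big_seq; apply: prodn_cond_gt0 => q.
by rewrite mem_primes => /and3P[/prime_gt0].
Qed.

Lemma size_constant_coef_fiber (n M : nat) (r : seq nat) (s : seq {poly int}) :
  (1 < n)%N -> uniq s ->
  (forall f, f \in s -> [/\ f \is monic, size f = n.+1, irreducible_elt f,
     (`|(f`_0)%R| <= M)%N & (0 < poly_index f)%N]) ->
  (forall f, f \in s -> exists2 Y, (0 < Y)%N && (Y \in r) &
     admissible n (poly_index f) Y) ->
  (forall i, (0 < i < n)%N -> {in s &, forall f g : {poly int}, f`_i = g`_i}) ->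
  (size s <= \sum_(Y <- r) n.-1 ^ size (primes Y) * (2 * M %/ Y ^ 2).+1)%N.
Proof.
case: s => [//|f0 s0]; set s := f0 :: s0 => n_gt1 us sP sY agree.
have f0s : f0 \in s by exact: mem_head.
have [f0_mon f0_sz _ _ _] := sP _ f0s.
pose g := f0 - (f0`_0)%:P.
have szC : (size (- (f0`_0)%:P : {poly int}) < size f0)%N.
  by rewrite size_polyN f0_sz ltnS (leq_trans (size_polyC_leq1 _)) // ltnW.
have sz_g : size g = n.+1 by rewrite /g size_polyDl.
have g_mon : g \is monic by rewrite monicE /g lead_coefDl // -monicE.
have fE f : f \in s -> f = g + (f`_0)%:P.
  move=> fs; have [f_mon f_sz _ _ _] := sP _ fs; apply/polyP => i.
  rewrite /g !coefD coefN !coefC; case: (ltngtP i 0) => // [i_gt0|->]; last by rewrite subrr add0r.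
  rewrite subr0 addr0; case: (ltngtP i n) => [i_n|i_n|->].
  - by apply: agree; rewrite // i_gt0.
  - by rewrite !nth_default ?f_sz ?f0_sz.
  - move: f_mon f0_mon; rewrite !monicE !lead_coefE f_sz f0_sz /= => /eqP -> /eqP ->.
    by [].
have [P [sz_P lead_P Pdiv]] := discriminant_poly (ltnW n_gt1) g_mon sz_g.
have /choice[y yP] : forall f, exists Y, f \in s ->
    [/\ (0 < Y)%N, Y \in r & admissible n (poly_index f) Y].
  move=> f; case: (boolP (f \in s)) => [/sY[Y /andP[Y0 Yr] adm]|_]; last by exists 0%N.
  by exists Y.
have sr : all (fun f => y f \in r) s by apply/allP => f /yP[].
apply: leq_trans (size_fibers sr) _; rewrite big_seq [X in (_ <= X)%N]big_seq.
apply: leq_sum => Y _.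
case E : [seq f <- s | y f == Y] => [//|f1 s1]; rewrite -E.
have Y_gt0 : (0 < Y)%N.
  have : f1 \in [seq f <- s | y f == Y] by rewrite E mem_head.
  by rewrite mem_filter => /andP[/eqP <- /yP[]].
pose S : set int := [set c | exists N, [/\ (0 < N)%N, admissible n N Y &
      exists2 w, w \in Aint & P.[c%:~R] = N%:R ^+ 2 * w]].
rewrite -(size_map (fun f : {poly int} => f`_0)).
apply: (@res_bound_interval S).
- by rewrite expn_gt0 Y_gt0.
- exact: (@res_bound_admissible n Y P).
- rewrite map_inj_in_uniq ?filter_uniq // => f f'.
  by rewrite !mem_filter => /andP[_ /fE ef] /andP[_ /fE ef'] e; rewrite ef ef' e.
move=> _ /mapP[f + ->]; rewrite mem_filter => /andP[/eqP yf fs].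
have [_ _ f_irr fM ind_gt0] := sP _ fs; split=> //.
exists (poly_index f); split=> //; first by have [_ _] := yP _ fs; rewrite yf.
by have := Pdiv f`_0; rewrite -fE //; apply.
Qed.

Definition in_modulus_range (R : realType) (n : nat) (H : R) (Y : nat) : bool :=
  (H ^+ (n * (n - 3) - n.-1) <= Y%:R ^+ (2 * n.-1) * (n ^ n)%N%:R) &&
  (Y%:R ^+ 2 <= H ^+ n).

Lemma counted_polys_modulus (R : realType) (n : nat) (eps H : R) (f : {poly int}) :
  (6 <= n)%N -> 0 < eps -> 1 <= H -> counted_polys n eps H f ->
  exists Y, [/\ (0 < Y)%N, admissible n (poly_index f) Y & in_modulus_range n H Y].
Proof.
move=> n6; have n1 : (0 < n.-1)%N by lia.
have n_gt1 : (1 < n)%N by lia.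
set D := (n * (n - 3) - n.-1)%N.
have DE : (n * (n - 3) = D + n.-1)%N by rewrite /D subnK //; nia.
have Dle : (D + 2 * n.-1 <= n * n.-1)%N by nia.
move: D DE Dle => D DE Dle eps0 H1 [_ _ _ _ []]; set N := poly_index f => radH HN.
have H0 : 0 < H by rewrite (lt_le_trans ltr01).
have Hge0 := ltW H0.
have N_gt0 : (0 < N)%N by rewrite -(ltr0n R) (le_lt_trans _ HN) // powR_ge0.
have rad_lt : (rad_nat N)%:R < H.
  have : H `^ (1 - eps) <= H `^ 1 by apply: (ler_powR H1); lra.
  by rewrite powRr1 // => /(lt_le_trans radH).
have N2 : H ^+ (D + n.-1) < N%:R ^+ 2.
  rewrite -DE -powR_mulrn //.
  have -> : (n * (n - 3))%N%:R = n%:R * (n%:R - 3) / 2 * 2%:R :> R.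
    by rewrite natrM natrB ?(leq_trans _ n6) //; field.
  rewrite powRrM powR_mulrn ?powR_ge0 //.
  by rewrite ltr_pXn2r ?nnegrE ?powR_ge0.
have [Y [Y_gt0 adm Nle]] := exists_admissible n_gt1 N_gt0.
pose T := fun d : nat => H ^+ D <= d%:R ^+ (2 * n.-1) * (n ^ n)%N%:R.
have TY : T Y.
  rewrite /T -(ler_pM2r (exprn_gt0 n.-1 H0)) -exprD.
  apply: le_trans (ltW N2) _.
  move: Nle; rewrite -(ler_nat R) !natrM !natrX => /le_trans; apply.
  rewrite mulrAC; apply: ler_wpM2l.
    by rewrite mulr_ge0 ?exprn_ge0.
  by rewrite lerXn2r ?nnegrE // ltW.
have [d [dY Td dmin]] := minimal_divisor Y_gt0 TY.
exists d; split; [exact: dvdn_gt0 dY | exact: admissible_dvdn dY | ].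
rewrite /in_modulus_range DE addnK; apply/andP; split=> //.
case: dmin => [->|[p [p_pr pd]]]; first by rewrite expr1n exprn_ege1.
rewrite /T -ltNge => dp.
have p_le : p%:R <= H.
  rewrite ltW // (le_lt_trans _ rad_lt) // ler_nat mem_primes_leq_rad //.
  by have [] := adm p p_pr (dvdn_trans pd dY).
rewrite -(ler_pXn2r n1) ?nnegrE ?exprn_ge0 // -!exprM.
have -> : d%:R = (d %/ p)%N%:R * p%:R :> R by rewrite -natrM divnK.
have nn1 : 1 <= (n ^ n)%N%:R :> R by rewrite ler1n expn_gt0 ltnW.
rewrite exprMn; apply: (@le_trans _ _ (H ^+ D * H ^+ (2 * n.-1))); last first.
  by rewrite -exprD; apply: ler_weXn2l.
apply: ler_pM; rewrite ?exprn_ge0 //; last by rewrite lerXn2r ?nnegrE // ltW.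
by apply: le_trans (ltW dp); rewrite ler_peMr ?exprn_ge0.
Qed.

Lemma size_counted (R : realType) (n : nat) (eps H : R) (s : seq {poly int}) :
  (6 <= n)%N -> 0 < eps -> 1 <= H -> uniq s ->
  (forall f, f \in s -> counted_polys n eps H f) ->
  (size s <= (\sum_(Y <- [seq Y <- iota 1 (Num.truncn (H ^+ n)) | in_modulus_range n H Y])
       n.-1 ^ size (primes Y) * (2 * Num.truncn (H ^+ n) %/ Y ^ 2).+1) *
     \prod_(i <- iota 1 n.-1) (2 * Num.truncn (H ^+ i)).+1)%N.
Proof.
move=> n6 eps0 H1 us sC.
have H0 : 0 <= H by rewrite (le_trans ler01).
have coefM f i : counted_polys n eps H f -> (1 <= i <= n)%N ->
    (`|(f`_(n - i))%R| <= Num.truncn (H ^+ i))%N.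
  move=> [_ _ _ cM _] /cM; rewrite truncn_ge_nat ?exprn_ge0 //.
  by rewrite natr_absz intr_norm.
apply: (@size_agree_fibers _ (fun i (f : {poly int}) => f`_(n - i)) _ _ _
  (counted_polys n eps H)) => //.
  by move=> f i Cf; rewrite mem_iota => i_r; apply: coefM => //; lia.
move=> t ut tC agree; apply: (@size_constant_coef_fiber n) => //; first by lia.
- move=> f /tC Cf; have := coefM f n Cf; rewrite subnn leqnn andbT => fM.
  have [f_mon f_sz f_irr _ [_ Hind]] := Cf; split=> //; first by apply: fM; lia.
  by rewrite -(ltr0n R) (le_lt_trans _ Hind) // powR_ge0.
- move=> f /tC Cf; have [Y [Y_gt0 adm rangeY]] := counted_polys_modulus n6 eps0 H1 Cf.
  exists Y => //; rewrite Y_gt0 mem_filter rangeY mem_iota Y_gt0 /= add1n ltnS.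
  rewrite truncn_ge_nat ?exprn_ge0 //; have /andP[_] := rangeY; apply: le_trans.
  by rewrite -natrX ler_nat -{1}[Y]expn1 leq_pexp2l.
- move=> i i_n f g ft gt; rewrite -(subKn (ltnW (andP i_n).2)).
  by apply: agree => //; rewrite mem_iota; lia.
Qed.

Lemma sum_inv_squares (R : realType) (a k : nat) : (0 < a)%N ->
  \sum_(a <= Y < a + k) (Y%:R ^+ 2)^-1 <= 2 / a%:R :> R.
Proof.
move=> a_gt0; have a0 : 0 < a%:R :> R by rewrite ltr0n.
case: k => [|k]; first by rewrite addn0 big_geq // divr_ge0.
suff : \sum_(a <= Y < a + k.+1) (Y%:R ^+ 2)^-1 <= 2 / a%:R - (a + k)%:R^-1 :> R.
  by move=> /le_trans; apply; rewrite gerBl invr_ge0.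
elim: k => [|k IHk].
  rewrite addn1 big_nat1 addn0.
  have -> : 2 / a%:R - a%:R^-1 = a%:R^-1 :> R by field; rewrite gt_eqF.
  by rewrite lef_pV2 ?posrE ?exprn_gt0 // -natrX ler_nat -{1}[a]expn1 leq_pexp2l.
rewrite addnS big_nat_recr ?leq_addr //=.
apply: le_trans (lerD IHk (lexx _)) _; rewrite addnS -[(a + k).+1%:R]natr1.
have : 1 <= (a + k)%:R :> R by rewrite ler1n ltn_addr.
set x := (a + k)%:R => x1; have x0 : 0 < x by lra.
rewrite -subr_ge0.
have -> : 2 / a%:R - (x + 1)^-1 - (2 / a%:R - x^-1 + ((x + 1) ^+ 2)^-1) = (x * (x + 1) ^+ 2)^-1.
  by field; rewrite !gt_eqF //; lra.
by rewrite invr_ge0 mulr_ge0 ?sqr_ge0 // ltW.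
Qed.

Lemma sum_inv_squares_filter (R : realType) (M : nat) (P : pred nat) (y0 : R) : 0 < y0 ->
  (forall Y, P Y -> y0 <= Y%:R) ->
  \sum_(Y <- [seq Y <- iota 1 M | P Y]) (Y%:R ^+ 2)^-1 <= 2 / y0.
Proof.
move=> y00 Py.
have sum_ge0 : 0 <= 2 / y0 by rewrite divr_ge0 // ltW.
have [exY|nexY] := pselect (exists Y, Y \in [seq Y <- iota 1 M | P Y]); last first.
  rewrite big_seq big1 // => Y YP; exfalso; apply: nexY; by exists Y.
case: (ex_minnP exY) => a; rewrite mem_filter mem_iota => /and3P[Pa a_gt0 aM] min_a.
apply: (@le_trans _ _ (2 / a%:R)); last first.
  by rewrite ler_pM2l // lef_pV2 ?posrE ?Py // ltr0n.
apply: le_trans (@sum_inv_squares R a (1 + M - a) a_gt0).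
rewrite subnKC ?(ltnW aM) // /index_iota.
have e1 : (1 + (a - 1) = a)%N by lia.
have e2 : (a - 1 + (1 + M - a) = M)%N by lia.
rewrite -{1}e2 iotaD e1 filter_cat big_cat /=.
rewrite [X in X + _]big_seq big1 ?add0r; last first.
  move=> Y; rewrite mem_filter mem_iota => /and3P[PY Y1 Ya].
  have : (a <= Y)%N by apply: min_a; rewrite mem_filter PY mem_iota Y1 /=; lia.
  lia.
by rewrite big_filter big_mkcond; apply: ler_sum => Y _; case: ifP.
Qed.

Lemma set_size_leq (T : choiceType) (A : set T) (b : nat) :
  (forall s : seq T, uniq s -> (forall x, x \in s -> A x) -> (size s <= b)%N) ->
  (set_size A <= b)%N.
Proof.
move=> Ab; rewrite /set_size; have [finA|infA] := pselect (finite_set A).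
  apply: Ab; first exact: fset_uniq.
  by move=> x; rewrite in_fset_set // inE.
by rewrite /fset_set; case: pselect => //= _; rewrite cardfs0.
Qed.

Lemma leq_truncn_double (R : realType) (x : R) : 1 <= x ->
  (2 * Num.truncn x).+1%:R <= 3 * x.
Proof.
move=> x1; have : (Num.truncn x)%:R <= x by rewrite Num.Theory.truncn_le; lra.
by rewrite -natr1 natrM; lra.
Qed.

Lemma prod_truncn_exp (R : realType) (H : R) (k : nat) : 1 <= H ->
  (\prod_(i <- iota 1 k) (2 * Num.truncn (H ^+ i)).+1)%N%:R <=
    3 ^+ k * H `^ (k%:R * (k%:R + 1) / 2).
Proof.
move=> H1; have H0 : 0 < H by lra.
elim: k => [|k IHk]; first by rewrite big_nil expr0 !mul0r powRr0 mulr1.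
rewrite -[X in iota _ X]addn1 iotaD big_cat big_seq1 natrM add1n [3 ^+ _]exprSr.
have -> : k.+1%:R * (k.+1%:R + 1) / 2 = k%:R * (k%:R + 1) / 2 + k.+1%:R :> R.
  by rewrite -[k.+1%:R]natr1; field.
rewrite powRD; last by apply/implyP => _; rewrite gt_eqF.
rewrite powR_mulrn ?(ltW H0) // mulrACA; apply: ler_pM => //.
by apply: leq_truncn_double; rewrite exprn_ege1.
Qed.

Lemma exp_size_primes_powR (R : realType) (K Y n : nat) (H : R) :
  (0 < K)%N -> (0 < Y)%N -> 1 <= H -> Y%:R ^+ 2 <= H ^+ n ->
  (K ^ size (primes Y))%N%:R <=
    ((K ^ 64) ^ (K ^ 64))%N%:R `^ (64^-1) * H `^ (n%:R / 128).
Proof.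
move=> K_gt0 Y_gt0 H1 YH; have H0 : 0 <= H by lra.
have L_gt0 : (0 < K ^ 64)%N by rewrite expn_gt0 K_gt0.
have := exp_size_primes_leq L_gt0 Y_gt0; rewrite -expnM mulnC expnM.
rewrite -(ler_nat R) natrX natrM; set a := (K ^ _)%N%:R; set c := (_ ^ _)%N%:R => aY.
have a0 : 0 <= a by rewrite ler0n.
have c0 : 0 <= c by rewrite ler0n.
have -> : a = (a ^+ 64) `^ (64^-1).
  by rewrite -(powR_mulrn 64 a0) -powRrM mulfV ?powRr1 // pnatr_eq0.
have -> : H `^ (n%:R / 128) = (H `^ (n%:R / 2)) `^ (64^-1).
  by rewrite -powRrM; congr (_ `^ _); field.
rewrite -powRM ?powR_ge0 //.
apply: ge0_ler_powR; rewrite ?nnegrE ?exprn_ge0 ?mulr_ge0 ?powR_ge0 ?invr_ge0 //.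
apply: le_trans aY _; apply: ler_wpM2l => //.
have YH' : 0 <= Y%:R :> R by rewrite ler0n.
have sqH : (H `^ (n%:R / 2)) ^+ 2 = H ^+ n.
  rewrite -(powR_mulrn 2 (powR_ge0 _ _)) -powRrM.
  by rewrite (_ : n%:R / 2 * 2%:R = n%:R) ?powR_mulrn //; field.
by rewrite -(@ler_pXn2r _ 2) ?nnegrE ?powR_ge0 // sqH.
Qed.

Lemma size_counted_powR (R : realType) (n : nat) (eps : R) : (6 <= n)%N -> 0 < eps ->
  exists2 C : R, 0 <= C & forall H : R, 1 <= H ->
    (set_size (counted_polys n eps H))%:R <=
      C * H `^ (n%:R / 128 + n%:R
        - (n%:R * (n%:R - 3) - (n%:R - 1)) / (2 * (n%:R - 1)) + n%:R * (n%:R - 1) / 2).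
Proof.
move=> n6 eps0; have K_gt0 : (0 < n.-1)%N by lia.
have D_le : (n.-1 <= n * (n - 3))%N by nia.
have nE : n%:R - 1 = n.-1%:R :> R by rewrite -subn1 natrB // (leq_trans _ n6).
pose c1 : R := ((n.-1 ^ 64) ^ (n.-1 ^ 64))%N%:R `^ (64^-1).
pose q : R := (2 * n.-1)%N%:R^-1.
pose c2 : R := (n ^ n)%N%:R `^ q.
have c1_ge0 : 0 <= c1 by exact: powR_ge0.
have q_gt0 : 0 < q by rewrite invr_gt0 ltr0n muln_gt0.
have nn_gt0 : 0 < (n ^ n)%N%:R :> R by rewrite ltr0n expn_gt0 (leq_trans _ n6).
have c2_gt0 : 0 < c2 by exact: powR_gt0.
exists (6 * c1 * c2 * 3 ^+ n.-1); first by rewrite !mulr_ge0 ?exprn_ge0 // ltW.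
move=> H H1; have H0 : 0 < H by lra.
have Hge0 := ltW H0.
pose D := (n * (n - 3) - n.-1)%N.
have DE : D%:R = n%:R * (n%:R - 3) - (n%:R - 1) :> R.
  by rewrite natrB // nE natrM natrB ?(leq_trans _ n6).
pose y0 := (H ^+ D / (n ^ n)%N%:R) `^ q.
have y0_gt0 : 0 < y0 by rewrite powR_gt0 // divr_gt0 // exprn_gt0.
have y0E : y0^-1 = c2 * H `^ (- (D%:R * q)).
  rewrite /y0 powRM ?invr_ge0 ?exprn_ge0 ?(ltW nn_gt0) // invfM mulrC.
  rewrite -powRN -(powR_mulrn D Hge0) -[X in _ * X]powRN -powRrM mulrN; congr (_ * _).
  by rewrite powRN -(powR_inv1 (ltW nn_gt0)) -powRrM mulN1r powRN invrK.
have y0_le Y : in_modulus_range n H Y -> y0 <= Y%:R.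
  move=> /andP[HY _].
  have -> : Y%:R = (Y%:R ^+ (2 * n.-1)) `^ q :> R.
    by rewrite -powR_mulrn // -powRrM mulfV ?powRr1 // pnatr_eq0 -lt0n muln_gt0.
  apply: ge0_ler_powR; rewrite ?nnegrE ?(ltW q_gt0) ?exprn_ge0 //.
    by rewrite divr_ge0 ?exprn_ge0.
  by rewrite ler_pdivrMr.
set M := Num.truncn (H ^+ n).
pose r := [seq Y <- iota 1 M | in_modulus_range n H Y].
have sum_le : (\sum_(Y <- r) n.-1 ^ size (primes Y) * (2 * M %/ Y ^ 2).+1)%N%:R <=
    c1 * H `^ (n%:R / 128) * (3 * H ^+ n) * (2 / y0).
  apply: (@le_trans _ _ (c1 * H `^ (n%:R / 128) * (3 * H ^+ n) *
      \sum_(Y <- r) (Y%:R ^+ 2)^-1)); last first.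
    apply: ler_wpM2l; first by rewrite !mulr_ge0 ?powR_ge0 ?exprn_ge0.
    exact: sum_inv_squares_filter.
  rewrite natr_sum mulr_sumr big_seq [X in _ <= X]big_seq; apply: ler_sum => Y.
  rewrite mem_filter mem_iota => /andP[/andP[_ YH] /andP[Y_gt0 _]].
  have Y2_gt0 : 0 < Y%:R ^+ 2 :> R by rewrite exprn_gt0 // ltr0n.
  rewrite natrM -mulrA; apply: ler_pM => //; first exact: exp_size_primes_powR.
  rewrite ler_pdivlMr //.
  have divM : (2 * M %/ Y ^ 2)%N%:R * Y%:R ^+ 2 <= 2 * H ^+ n :> R.
    apply: (@le_trans _ _ (2 * M)%N%:R).
      by rewrite -natrX -natrM ler_nat leq_divM.
    by rewrite natrM ler_pM2l // Num.Theory.truncn_le exprn_ge0.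
  by rewrite -natr1 mulrDl mul1r; lra.
apply: (@le_trans _ _ ((c1 * H `^ (n%:R / 128) * (3 * H ^+ n) * (2 / y0)) *
    (3 ^+ n.-1 * H `^ (n.-1%:R * (n.-1%:R + 1) / 2)))).
  apply: (@le_trans _ _ ((\sum_(Y <- r) n.-1 ^ size (primes Y) * (2 * M %/ Y ^ 2).+1) *
      \prod_(i <- iota 1 n.-1) (2 * Num.truncn (H ^+ i)).+1)%N%:R).
    by rewrite ler_nat; apply: set_size_leq => s us sC; exact: (size_counted n6 eps0 H1).
  by rewrite natrM; apply: ler_pM => //; exact: prod_truncn_exp.
rewrite y0E -(powR_mulrn n Hge0) le_eqVlt; apply/orP; left; apply/eqP.
have HD x y : H `^ (x + y) = H `^ x * H `^ y.
  by rewrite powRD //; apply/implyP => _; rewrite gt_eqF.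
have -> : (n%:R * (n%:R - 3) - (n%:R - 1)) / (2 * (n%:R - 1)) = D%:R * q :> R.
  by rewrite /q DE nE natrM.
have -> : n%:R * (n%:R - 1) / 2 = n.-1%:R * (n.-1%:R + 1) / 2 :> R.
  by rewrite -nE; field.
by rewrite !HD; ring.
Qed.

Theorem theorem2p6 (R : realType) (n : nat) (hn : (6 <= n)%N) (eps : R)
    (heps : 0 < eps) :
  exists C : R, forall H : R, 1 <= H ->
    (set_size (counted_polys n eps H))%:R <=
      C * (H `^ ((n%:R ^+ 2 + n%:R) / 2 - 4 / 3 - 4 / n%:R + eps)
           + H `^ ((n%:R ^+ 2 + n%:R) / 2 - 2 * n%:R / 3 + 3 + eps)).
Proof.
have [C C_ge0 CP] := size_counted_powR hn heps.
exists C => H H1; apply: le_trans (CP H H1) _; apply: ler_wpM2l => //.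
have [n8|n7] := leqP 8 n.
  apply: ler_wpDr; first exact: powR_ge0.
  apply: (ler_powR H1).
  have x8 : 8 <= n%:R :> R by rewrite (ler_nat R 8).
  move: x8; set x : R := n%:R => x8.
  have i1 : 4 / x <= 1 / 2 by rewrite ler_pdivrMr; lra.
  have i2 : 1 / (x - 1) <= 1 / 7 by rewrite ler_pdivrMr; lra.
  have -> : (x * (x - 3) - (x - 1)) / (2 * (x - 1)) = (x - 3) / 2 - 1 / (x - 1).
    by field; lra.
  move: i1 i2; set a := 4 / x; set b := 1 / (x - 1) => i1 i2.
  lra.
apply: ler_wpDl; first exact: powR_ge0.
apply: (ler_powR H1).
have [->|->] : n = 6%N \/ n = 7%N by lia.
  have -> : (6%:R * (6%:R - 3) - (6%:R - 1)) / (2 * (6%:R - 1)) = 13 / 10 :> R by field.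
  lra.
have -> : (7%:R * (7%:R - 3) - (7%:R - 1)) / (2 * (7%:R - 1)) = 11 / 6 :> R by field.
lra.
Qed.
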